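(* Let $G$ be a finite connected undirected graph (multiple edges and loops allowed). Let $\Gamma$ be a finite group and $\pi:\Gamma\to\mathrm{GL}_d(\mathbb{C})$ a $d$-dimensional representation such that all the exterior powers $\bigwedge^m\pi$, $0\le m\le d$, are irreducible and pairwise non-isomorphic. Then $$\mathbb{E}_{\gamma}\left[\phi_{\gamma,\pi}(x)\right]=\mathbb{E}_{H\in\mathcal{C}_{d,G}}\left[\mathcal{M}_H(x)\right],$$ where the left-hand expectation is over a uniformly random $\Gamma$-labeling $\gamma$ of $G$, $\phi_{\gamma,\pi}$ is the characteristic polynomial of the $(\Gamma,\pi)$-covering $A_{\gamma,\pi}$ of $G$, the right-hand expectation is over a uniformly random $d$-covering $H$ of $G$, and $\mathcal{M}_H$ is the matching polynomial of $H$. In particular, under this condition on $(\Gamma,\pi)$, $\mathbb{E}_\gamma[\phi_{\gamma,\pi}(x)]$ depends only on $d$ (and $G$) and not on $(\Gamma,\pi)$.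
   Context: Orient each edge of $G$ arbitrarily; $E^+(G)$ is the resulting set of oriented edges, $E^-(G)$ the set of their reverses, $E(G)=E^+(G)\sqcup E^-(G)$ (so each loop gives two elements of $E(G)$), $-e$ is the reverse of $e$, and $h(e),t(e)$ are the head and tail of $e$. $\Gamma$-labelings: a $\Gamma$-labeling of $G$ is a function $\gamma:E(G)\to\Gamma$ with $\gamma(-e)=\gamma(e)^{-1}$; the labelings are given the uniform distribution. With $n=|V(G)|$, $A_{\gamma,\pi}$ is the $nd\times nd$ matrix made of $d\times d$ blocks indexed by pairs $(u,v)\in V(G)^2$, where the $(u,v)$ block is $\sum_{e\in E(G):\,t(e)=u,\,h(e)=v}\pi(\gamma(e))$ (zero if there are no such edges), and $\phi_{\gamma,\pi}(x)=\det(xI-A_{\gamma,\pi})$. $d$-coverings: $\mathcal{C}_{d,G}$ is the set of functions $\sigma:E(G)\to S_d$ with $\sigma(-e)=\sigma(e)^{-1}$, with uniform distribution; $\sigma$ is identified with the graph $H$ with vertex set $\{v_i:v\in V(G),1\le i\le d\}$ which has, for each $e\in E^+(G)$, the $d$ edges joining $t(e)_i$ to $h(e)_{\sigma(e)(i)}$, $1\le i\le d$. The matching polynomial of a finite graph $H$ on $N$ vertices is $\mathcal{M}_H(x)=\sum_{i=0}^{\lfloor N/2\rfloor}(-1)^i m_i x^{N-2i}$, where $m_i$ is the number of matchings in $H$ with $i$ edges (sets of $i$ non-loop edges, no two sharing a vertex; parallel edges are regarded as distinct) and $m_0=1$. *)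

(* Defs.v *)
From HB Require Import structures.
From mathcomp Require Import all_boot all_order all_algebra all_fingroup.
From mathcomp Require Import mxrepresentation complex reals.

Set Implicit Arguments.
Unset Strict Implicit.
Unset Printing Implicit Defensive.

Import GRing.Theory.
Local Open Scope ring_scope.

(* A finite undirected graph, with loops and parallel edges, presented with an
   arbitrary orientation: [edge] is E^+(G). *)
Record multigraph := Multigraph {
  vertex : finType;
  edge : finType;
  etail : edge -> vertex;
  ehead : edge -> vertex }.

Section Graph.
Variable G : multigraph.

(* E(G) = E^+(G) + E^-(G): (e, false) is e and (e, true) is its reverse; a loop
   gives two darts. *)
Definition dart := (edge G * bool)%type.

Definition rev_dart (e : dart) : dart := (e.1, ~~ e.2).
Definition dtail (e : dart) : vertex G := if e.2 then ehead e.1 else etail e.1.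
Definition dhead (e : dart) : vertex G := if e.2 then etail e.1 else ehead e.1.

Definition adjacent : rel (vertex G) :=
  fun u v => [exists e : dart, (dtail e == u) && (dhead e == v)].

Definition connected_graph : Prop := forall u v : vertex G, connect adjacent u v.

Definition edge_ends (e : edge G) : {set vertex G} := [set etail e; ehead e].

Definition is_matching (M : {set edge G}) : bool :=
  [forall e in M, etail e != ehead e] &&
  [forall e in M, forall f in M,
     (e != f) ==> [disjoint edge_ends e & edge_ends f]].

Definition nb_matchings (i : nat) : nat :=
  #|[set M : {set edge G} | is_matching M & #|M| == i]|.

Definition matching_poly (C : nzRingType) : {poly C} :=
  \sum_(i < (#|vertex G|./2).+1)
    ((-1) ^+ i * (nb_matchings i)%:R) *: 'X^(#|vertex G| - i.*2).

Definition labelings (gT : finGroupType) : {set {ffun dart -> gT}} :=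
  [set g : {ffun dart -> gT} |
     [forall e : dart, g (rev_dart e) == (g e)^-1%g]].

Definition coverings (d : nat) : {set {ffun dart -> 'S_d}} := labelings 'S_d.

Definition covering_graph (d : nat) (s : {ffun dart -> 'S_d}) : multigraph :=
  @Multigraph (vertex G * 'I_d)%type (edge G * 'I_d)%type
    (fun e => (etail e.1, e.2))
    (fun e => (ehead e.1, s (e.1, false) e.2)).

Definition labeled_adj (C : comUnitRingType) (gT : finGroupType) (d : nat)
    (rG : mx_representation C [set: gT]%G d) (g : {ffun dart -> gT}) :
    'M[C]_(\sum_(i < #|vertex G|) d) :=
  \mxblock_(i < #|vertex G|, j < #|vertex G|)
    (\sum_(e : dart | (dtail e == enum_val i) && (dhead e == enum_val j))
       rG (g e) : 'M[C]_d).

Definition labeled_char_poly (C : comUnitRingType) (gT : finGroupType)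
    (d : nat) (rG : mx_representation C [set: gT]%G d)
    (g : {ffun dart -> gT}) : {poly C} :=
  char_poly (labeled_adj rG g).

End Graph.

Definition uniform_expectation (C : fieldType) (T : finType) (S : {set T})
    (f : T -> {poly C}) : {poly C} :=
  (#|S|%:R)^-1 *: \sum_(x in S) f x.

Definition incr_tuples (m d : nat) : {set m.-tuple 'I_d} :=
  [set t : m.-tuple 'I_d | sorted ltn (map val t)].

Section ExteriorPower.
Variables (C : comUnitRingType) (d m : nat).

(* The m-th exterior power of C^d in its standard basis
   e_s = e_(s_1) /\ ... /\ e_(s_m), s ranging over incr_tuples m d. If X has
   rows v_1, ..., v_m, then wedge X lists the coordinates of
   v_1 /\ ... /\ v_m. *)
Definition wedge (X : 'M[C]_(m, d)) : 'rV[C]_#|incr_tuples m d| :=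
  \row_j \det (colsub (tnth (enum_val j)) X).

(* The matrix of e_s |-> (e_(s_1) A) /\ ... /\ (e_(s_m) A). *)
Definition ext_mx (A : 'M[C]_d) : 'M[C]_#|incr_tuples m d| :=
  \matrix_i wedge (rowsub (tnth (enum_val i)) A).

Lemma incr_tuple_inj (s : m.-tuple 'I_d) :
  s \in incr_tuples m d -> injective (tnth s).
Proof.
rewrite inE => hs; apply/tuple_uniqP.
by move: hs; rewrite ltn_sorted_uniq_leq (map_inj_uniq val_inj) => /andP[].
Qed.

Lemma incr_tuple_perm (s t : m.-tuple 'I_d) :
  s \in incr_tuples m d -> t \in incr_tuples m d -> perm_eq s t -> s = t.
Proof.
rewrite !inE => hs ht st; apply: val_inj; apply: (inj_map val_inj).
by apply: (irr_sorted_eq ltn_trans ltnn hs ht); apply/perm_mem/perm_map.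
Qed.

Lemma det_mulmx_ffun (X : 'M[C]_(m, d)) (A : 'M[C]_(d, m)) :
  \det (X *m A) =
  \sum_(f : {ffun 'I_m -> 'I_d}) (\prod_i X i (f i)) * \det (rowsub f A).
Proof.
transitivity (\sum_(s : 'S_m) \sum_(f : {ffun 'I_m -> 'I_d})
    (-1) ^+ s * \prod_i (X i (f i) * A (f i) (s i))).
  apply: eq_bigr => s _; rewrite -big_distrr /=; congr (_ * _).
  rewrite -(bigA_distr_bigA (fun i k => X i k * A k (s i))) /=.
  by apply: eq_bigr => i _; rewrite mxE.
rewrite exchange_big; apply: eq_bigr => f _; rewrite big_distrr /=.
apply: eq_bigr => s _; rewrite big_split /= mulrCA; congr (_ * (_ * _)).
by apply: eq_bigr => i _; rewrite mxE.
Qed.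

Lemma Cauchy_Binet (X : 'M[C]_(m, d)) (A : 'M[C]_(d, m)) :
  \det (X *m A) =
  \sum_(s in incr_tuples m d)
     \det (colsub (tnth s) X) * \det (rowsub (tnth s) A).
Proof.
rewrite det_mulmx_ffun (bigID (fun f : {ffun _} => injectiveb f)) /=.
rewrite addrC big1 ?add0r => [|f /injectivePn[i1 [i2 Di12 Ef12]]]; last first.
  by rewrite (determinant_alternate Di12) ?mulr0 // => j; rewrite !mxE Ef12.
pose le_ord := relpre (val : 'I_d -> nat) leq.
have szf (f : {ffun 'I_m -> 'I_d}) : size (sort le_ord (codom f)) == m.
  by rewrite size_sort size_codom card_ord.
pose S f := Tuple (szf f).
have permS f : perm_eq (S f) (codom f) by rewrite /S /= perm_sort.
have incrS (f : {ffun _}) : injectiveb f -> S f \in incr_tuples m d.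
  move=> injf; rewrite inE ltn_sorted_uniq_leq (map_inj_uniq val_inj).
  rewrite (perm_uniq (permS f)); apply/andP; split; first exact: injf.
  by rewrite sorted_map /=; apply: sort_sorted => x y; exact: leq_total.
rewrite (partition_big S (mem (incr_tuples m d))) //=.
apply: eq_bigr => s hs; have injs := incr_tuple_inj hs.
pose h (t : 'S_m) := [ffun i => tnth s (t i)].
have injh : injective h.
  move=> t1 t2 /ffunP e; apply/permP => i.
  by move: (e i); rewrite !ffunE => /injs.
transitivity (\sum_(f in [set h t | t in [set: 'S_m]])
   (\prod_i X i (f i)) * \det (rowsub f A)).
  apply: eq_bigl => f; apply/idP/imsetP => [/andP[_ /eqP e]|[t _ ->]].
    have: perm_eq (codom f) s by rewrite perm_sym -e permS.
    case/tuple_permP => t et; exists t => //; apply/ffunP => i; rewrite ffunE.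
    have {}et : [tuple f j | j < m] = [tuple tnth s (t j) | j < m].
      by apply: val_inj; rewrite /= -et codomE.
    by have := congr1 (fun u => tnth u i) et; rewrite !tnth_mktuple.
  have injht : injectiveb (h t).
    by apply/injectiveP => i j; rewrite !ffunE => /injs /perm_inj.
  rewrite injht /=; apply/eqP; apply: (incr_tuple_perm _ hs).
    exact: incrS.
  rewrite (perm_trans (permS _)) //; apply/tuple_permP; exists t.
  by rewrite /= codomE; apply: eq_map => i; rewrite ffunE.
rewrite big_imset /=; last by move=> t1 t2 _ _; exact: injh.
rewrite [X in X * _]/determinant big_distrl /=.
apply: eq_big => [t|t _]; first by rewrite inE.
have -> : rowsub (h t) A = row_perm t (rowsub (tnth s) A).
  by apply/matrixP => i j; rewrite !mxE ffunE.
rewrite row_permE det_mulmx det_perm mulrCA mulrA; congr (_ * _ * _).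
by apply: eq_bigr => i _; rewrite !mxE ffunE.
Qed.

Lemma wedge_mul (X : 'M[C]_(m, d)) (A : 'M[C]_d) :
  wedge (X *m A) = wedge X *m ext_mx A.
Proof.
apply/rowP => j; rewrite !mxE.
have -> : colsub (tnth (enum_val j)) (X *m A) =
          X *m colsub (tnth (enum_val j)) A.
  by apply/matrixP => a b; rewrite !mxE; apply: eq_bigr => k _; rewrite !mxE.
rewrite Cauchy_Binet big_enum_val /=; apply: eq_bigr => i _.
rewrite !mxE; congr (_ * \det _).
by apply/matrixP => a b; rewrite !mxE.
Qed.

Lemma ext_mx1 : ext_mx 1%:M = 1%:M.
Proof.
apply/matrixP => i j; rewrite !mxE; case: (eqVneq i j) => [<-|nij].
  rewrite -[RHS](det1 C m); congr (\det _); apply/matrixP => a b; rewrite !mxE.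
  by rewrite (inj_eq (incr_tuple_inj (enum_valP i))).
apply: big1 => s _.
suff [k hk] : exists k : 'I_m,
    tnth (enum_val i) k != tnth (enum_val j) (s k).
  by rewrite (bigD1 k) //= !mxE (negbTE hk) mul0r mulr0.
apply/existsP; apply: contraR nij => /existsPn h.
have e k : tnth (enum_val i) k = tnth (enum_val j) (s k).
  by apply/eqP/negPn.
apply/eqP/enum_val_inj/incr_tuple_perm; [exact: enum_valP..|].
apply/tuple_permP; exists s; apply: (congr1 val (_ : _ = mktuple _)).
by apply: eq_from_tnth => k; rewrite tnth_mktuple.
Qed.

Lemma ext_mxM (A B : 'M[C]_d) : ext_mx (A *m B) = ext_mx A *m ext_mx B.
Proof.
apply/row_matrixP => i; rewrite row_mul !rowK -wedge_mul; congr wedge.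
by apply/matrixP => a b; rewrite !mxE; apply: eq_bigr => k _; rewrite !mxE.
Qed.

End ExteriorPower.

Section ExteriorRepr.
Variables (C : comUnitRingType) (gT : finGroupType) (G : {group gT}) (d : nat).
Variables (rG : mx_representation C G d) (m : nat).

Lemma ext_mx_repr : mx_repr G (fun g => ext_mx m (rG g)).
Proof.
split=> [|x y Gx Gy]; first by rewrite repr_mx1 ext_mx1.
by rewrite repr_mxM // ext_mxM.
Qed.

Definition ext_repr : mx_representation C G #|incr_tuples m d| :=
  MxRepresentation ext_mx_repr.

End ExteriorRepr.

Definition ext_powers_irr_distinct (C : fieldType) (gT : finGroupType)
    (G : {group gT}) (d : nat) (rG : mx_representation C G d) : Prop :=
  (forall m : nat, (m <= d)%N -> mx_irreducible (ext_repr rG m)) /\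
  (forall m1 m2 : nat, (m1 <= d)%N -> (m2 <= d)%N -> m1 <> m2 ->
     ~ mx_rsim (ext_repr rG m1) (ext_repr rG m2)).

(* Main.v *)
(* Expanding a determinant by Cauchy-Binet and Laplace, det(B + U P V + W Q Z) is
   a linear combination of products of a minor of P and a minor of Q. For an
   edge labelled g, P = pi(g) and Q = pi(g^-1), and Schur orthogonality for the
   exterior powers shows that the average of a product of two such minors
   depends only on d. A uniform signed permutation matrix (with its inverse) has
   the same averages, so the labels may be replaced, one edge at a time, by
   random signed permutations. The resulting matrix is the adjacency matrix of a
   random d-covering with independent random signs on its edges, and averaging
   over the signs gives the matching polynomial (Godsil-Gutman). *)
Require Import Defs.
From mathcomp Require Import all_boot all_order all_algebra all_fingroup.
From mathcomp Require Import mxrepresentation complex reals ring.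

Set Implicit Arguments.
Unset Strict Implicit.
Unset Printing Implicit Defensive.

Import GRing.Theory Num.Theory.
Local Open Scope ring_scope.

Lemma sum_setT (T : finType) (V : nmodType) (F : T -> V) :
  \sum_(x in [set: T]) F x = \sum_x F x.
Proof. by apply: eq_bigl => x; rewrite inE. Qed.

(** * Determinants as combinations of minors *)

Section NullWeights.
Variables (C : comUnitRingType) (d : nat) (K : finType).
Implicit Types (w : K -> C) (P Q : K -> 'M[C]_d).

(** The weights may have signs: taken as the difference of two uniform laws, the vanishing says that
    both laws have the same average minors. *)
Definition ext_null w P :=
  forall m i j, \sum_k w k * ext_mx m (P k) i j = 0.

(** Cauchy-Binet splits off the minors of [V]; by functoriality of exterior powers the other factor
    is linear in the entries of [ext_mx n (P k)]. Writing the selected rows as rows of the identity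
    times [P k] allows [h] to repeat or reorder them. *)
Lemma ext_null_rowsub_mul w P (nP : ext_null w P) n (h : 'I_n -> 'I_d)
    (V : 'M[C]_(d, n)) :
  \sum_k w k * \det (rowsub h (P k) *m V) = 0.
Proof.
under eq_bigr => k _.
  have -> : rowsub h (P k) = rowsub h 1%:M *m P k.
    by rewrite mul_rowsub_mx mul1mx.
  rewrite Cauchy_Binet big_enum_val big_distrr /=.
  under eq_bigr => j _.
    have -> : \det (colsub (tnth (enum_val j)) (rowsub h 1%:M *m P k)) =
        wedge (rowsub h 1%:M *m P k) 0 j by rewrite mxE.
    rewrite wedge_mul mxE big_distrl big_distrr /=.
    over.
  over.
rewrite exchange_big big1 //= => j _; rewrite exchange_big big1 //= => i _.
set a := wedge _ 0 i; set b := \det _.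
rewrite (eq_bigr (fun k => a * b * (w k * ext_mx n (P k) i j))).
  by rewrite -big_distrr /= nP mulr0.
by move=> k _; ring.
Qed.

(** Laplace expansion along a constant row ([inl]) leaves a smaller matrix of the same kind. Once no
    constant row is left, the previous lemma applies. *)
Lemma ext_null_rows w P (nP : ext_null w P) n (r : 'I_n -> 'rV[C]_n + 'I_d)
    (V : 'M[C]_(d, n)) :
  \sum_k w k * \det (\matrix_i match r i with
                               | inl b => b
                               | inr a => row a (P k *m V) end) = 0.
Proof.
have no_const n' (r' : 'I_n' -> 'rV[C]_n' + 'I_d) (V' : 'M[C]_(d, n')) :
    (forall i, exists a, r' i == inr a) ->
    \sum_k w k * \det (\matrix_i match r' i with
                               | inl b => b
                               | inr a => row a (P k *m V') end) = 0.
  move=> hinr.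
  rewrite -[RHS](ext_null_rowsub_mul nP (fun i => xchoose (hinr i)) V').
  apply: eq_bigr => k _; congr (_ * \det _); apply/row_matrixP => i.
  by rewrite rowK (eqP (xchooseP (hinr i))); apply/rowP => j; rewrite !mxE;
    apply: eq_bigr => c _; rewrite !mxE.
elim: n r V => [|n IHn] r V; first by apply: no_const => -[].
case: (pickP (fun i => if r i is inl _ then true else false)) => [i0|noinl];
  last first.
  by apply: no_const => i; case: (r i) (noinl i) => // a _; exists a.
case ri0: (r i0) => [b|//] _.
under eq_bigr => k _ do rewrite (expand_det_row _ i0) big_distrr /=.
rewrite exchange_big big1 //= => j _.
pose r' i := match r (lift i0 i) with inl b => inl (col' j b) | inr a => inr a end.
rewrite (eq_bigr (fun k => b 0 j * (-1) ^+ (i0 + j) *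
   (w k * \det (\matrix_i match r' i with
                     | inl b => b
                     | inr a => row a (P k *m col' j V) end)))).
  by rewrite -big_distrr /= IHn mulr0.
move=> k _; rewrite mxE ri0 /cofactor.
set D := \det _; set D' := \det _.
suff -> : D = D' by rewrite mulrCA -mulrA; congr (_ * _); rewrite mulrCA.
congr (\det _); apply/matrixP => i j'; rewrite !mxE /r'.
case: (r (lift i0 i)) => [b'|a]; rewrite !mxE //.
by apply: eq_bigr => c _; rewrite !mxE.
Qed.

(** Each row of the product of [row_mx 1%:M U] and [col_mx B (P k *m V)] combines rows of the second
    factor, so multilinearity leaves determinants whose rows are constant or come from
    [P k *m V]. *)
Lemma ext_null_det w P (nP : ext_null w P) n (B : 'M[C]_n) (U : 'M_(n, d))
    (V : 'M_(d, n)) :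
  \sum_k w k * \det (B + U *m P k *m V) = 0.
Proof.
under eq_bigr => k _.
  have -> : B + U *m P k *m V = row_mx 1%:M U *m col_mx B (P k *m V).
    by rewrite mul_row_col mul1mx mulmxA.
  rewrite det_mulmx_ffun big_distrr /=.
  over.
rewrite exchange_big big1 //= => f _.
pose r i := match split (f i) with inl a => inl (row a B) | inr a => inr a end.
rewrite (eq_bigr (fun k => (\prod_i row_mx 1%:M U i (f i)) *
   (w k * \det (\matrix_i match r i with
                     | inl b => b
                     | inr a => row a (P k *m V) end)))).
  by rewrite -big_distrr /= ext_null_rows ?mulr0.
move=> k _; rewrite mulrCA; congr (_ * (_ * \det _)).
apply/row_matrixP => i; rewrite rowK /r.
by apply/rowP => j; rewrite !mxE; case: splitP => a _; rewrite !mxE.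
Qed.

Lemma ext_null_det2 w P Q :
  (forall m m' i j i' j',
     \sum_k w k * (ext_mx m (P k) i j * ext_mx m' (Q k) i' j') = 0) ->
  forall n (B : 'M[C]_n) (U W : 'M_(n, d)) (V Z : 'M_(d, n)),
  \sum_k w k * \det (B + U *m P k *m V + W *m Q k *m Z) = 0.
Proof.
move=> nPQ n B U W V Z.
under eq_bigr => k _.
  have -> : B + U *m P k *m V + W *m Q k *m Z =
      row_mx (B + U *m P k *m V) W *m col_mx 1%:M (Q k *m Z).
    by rewrite mul_row_col mulmx1 !mulmxA.
  rewrite Cauchy_Binet big_distrr /=.
  over.
rewrite exchange_big big1 //= => s _; set f := tnth s.
pose B1 := colsub f (row_mx B W); pose V1 := colsub f (row_mx V 0).
pose B2 := rowsub f (col_mx 1%:M 0) : 'M[C]_n.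
pose U2 := rowsub f (col_mx 0 1%:M) : 'M[C]_(n, d).
have eP k : colsub f (row_mx (B + U *m P k *m V) W) = B1 + U *m P k *m V1.
  rewrite /B1 /V1 mulmx_colsub -linearD /= mul_mx_row mulmx0 add_row_mx.
  by rewrite addr0.
have eQ k : rowsub f (col_mx 1%:M (Q k *m Z)) = B2 + U2 *m Q k *m Z.
  rewrite /B2 /U2 -mulmxA mul_rowsub_mx -linearD /= mul_col_mx mul0mx mul1mx.
  by rewrite add_col_mx addr0 add0r.
under eq_bigr => k _ do rewrite eP eQ mulrA.
(* The determinant in [P k] first counts as a weight for the family [Q]; afterwards the minor of
   [Q k] counts as a weight for the family [P]. *)
apply: ext_null_det => m' i' j'.
rewrite (eq_bigr (fun k => (w k * ext_mx m' (Q k) i' j') *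
                            \det (B1 + U *m P k *m V1))) => [|k _]; last first.
  by rewrite mulrAC.
apply: ext_null_det => m i j; rewrite -[RHS](nPQ m m' i j i' j').
by apply: eq_bigr => k _; rewrite -mulrA [X in _ * X]mulrC.
Qed.

End NullWeights.

(** * Schur orthogonality *)

Section SchurOrthogonality.
Variables (C : fieldType) (gT : finGroupType) (G : {group gT}).

(** Schur's lemma: the kernel and the row space of [B] are submodules, so a nonzero [B] would be an
    isomorphism. *)
Lemma intertwiner_nonsim_eq0 n1 n2 (r1 : mx_representation C G n1)
    (r2 : mx_representation C G n2) (B : 'M[C]_(n1, n2)) :
  mx_irreducible r1 -> mx_irreducible r2 -> ~ mx_rsim r1 r2 ->
  {in G, forall x, r1 x *m B = B *m r2 x} -> B = 0.
Proof.
move=> /mx_irrP[_ irr1] /mx_irrP[_ irr2] nsim rB.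
have [//|nzB] := eqVneq B 0; case: nsim.
have freeB : row_free B.
  rewrite -kermx_eq0; apply: contraNT nzB => nzK.
  have /irr1/(_ nzK) : mxmodule r1 (kermx B).
    apply/mxmoduleP => x Gx; apply/sub_kermxP.
    by rewrite -mulmxA rB // mulmxA mulmx_ker mul0mx.
  by rewrite -sub1mx => /sub_kermxP; rewrite mul1mx => ->.
have fullB : row_full B.
  have /irr2 : mxmodule r2 <<B>>%MS.
    apply/mxmoduleP => x Gx; rewrite genmxE.
    by rewrite (eqmxMr _ (genmxE B)) -rB // submxMl.
  rewrite -mxrank_eq0 genmxE mxrank_eq0 => /(_ nzB).
  by rewrite /row_full genmxE.
by exists B => //; rewrite -(eqP freeB) (eqP fullB).
Qed.

(** The substitution of [x * g] for [g] turns left multiplication by [r1 x] into right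
    multiplication by [r2 x]. *)
Lemma sum_conj_intertwiner n1 n2 (r1 : mx_representation C G n1)
    (r2 : mx_representation C G n2) (X : 'M[C]_(n1, n2)) :
  {in G, forall x, r1 x *m (\sum_(g in G) r1 g *m X *m r2 g^-1%g) =
                   (\sum_(g in G) r1 g *m X *m r2 g^-1%g) *m r2 x}.
Proof.
move=> x Gx; rewrite mulmx_sumr mulmx_suml.
rewrite [RHS](reindex_inj (mulgI x)) /=.
apply: eq_big => [g|g Gg]; first by rewrite groupMl.
rewrite invMg !repr_mxM ?groupV // !mulmxA -[RHS]mulmxA -(repr_mxM r2) ?groupV //.
by rewrite mulVg repr_mx1 mulmx1.
Qed.

Lemma sum_conj_coef n1 n2 (r1 : mx_representation C G n1)
    (r2 : mx_representation C G n2) i j i' j' :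
  (\sum_(g in G) r1 g *m delta_mx j i' *m r2 g^-1%g) i j' =
  \sum_(g in G) r1 g i j * r2 g^-1%g i' j'.
Proof.
rewrite summxE; apply: eq_bigr => g _.
rewrite -mulmxA mxE (bigD1 j) //= big1 ?addr0 => [|k nkj].
  congr (_ * _); rewrite mxE (bigD1 i') //= big1 ?addr0 => [|k nki].
    by rewrite mxE !eqxx mul1r.
  by rewrite mxE (negbTE nki) andbF mul0r.
by rewrite mxE big1 ?mulr0 // => l _; rewrite mxE (negbTE nkj) mul0r.
Qed.

Lemma schur_orthogonality_nonsim n1 n2 (r1 : mx_representation C G n1)
    (r2 : mx_representation C G n2) i j i' j' :
  mx_irreducible r1 -> mx_irreducible r2 -> ~ mx_rsim r1 r2 ->
  \sum_(g in G) r1 g i j * r2 g^-1%g i' j' = 0.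
Proof.
move=> irr1 irr2 nsim; rewrite -sum_conj_coef.
rewrite (intertwiner_nonsim_eq0 irr1 irr2 nsim
  (@sum_conj_intertwiner _ _ r1 r2 _)).
by rewrite mxE.
Qed.

End SchurOrthogonality.

(** The averaged conjugate of a matrix unit commutes with [rG] and has an eigenvalue, so it is
    scalar, and its trace gives the scalar. Keeping [n] as a factor avoids dividing by it in
    positive characteristic. *)
Lemma schur_orthogonality (C : closedFieldType) (gT : finGroupType)
    (G : {group gT}) n (rG : mx_representation C G n) i j i' j' :
  mx_irreducible rG ->
  n%:R * \sum_(g in G) rG g i j * rG g^-1%g i' j' =
    #|G|%:R * ((i == j') && (j == i'))%:R.
Proof.
move=> irrG; have [n_gt0 irr] := (mx_irrP rG).1 irrG.
rewrite -sum_conj_coef; set S := \sum_(g in G) _.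
have cS : {in G, forall x, rG x *m S = S *m rG x} by exact: sum_conj_intertwiner.
have [a /eigenvalueP[v vS nzv]] : {a | eigenvalue S a}.
  have /closed_rootP/sigW[a ra] : size (char_poly S) != 1%N.
    by rewrite size_char_poly eqSS -lt0n.
  by exists a; rewrite eigenvalue_root_char.
have Sa : S = a%:M.
  apply/eqP; rewrite -subr_eq0; apply/eqP.
  (* The eigenspace of [a] is a nonzero submodule, hence the whole space. *)
  have : row_full (kermx (S - a%:M)).
    apply: irr; last first.
      apply: contra_neq nzv => K0; apply/eqP; rewrite -submx0 -K0.
      by apply/sub_kermxP; rewrite mulmxBr vS mul_mx_scalar subrr.
    apply/mxmoduleP => x Gx; apply/sub_kermxP.
    rewrite -mulmxA mulmxBr cS // scalar_mxC -mulmxBl mulmxA mulmx_ker.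
    by rewrite mul0mx.
  by rewrite -sub1mx => /sub_kermxP; rewrite mul1mx.
have trS : \tr S = #|G|%:R * (j == i')%:R.
  rewrite raddf_sum /=; under eq_bigr => g Gg.
    rewrite mxtrace_mulC mulmxA -repr_mxM ?groupV // mulVg repr_mx1 mul1mx.
    rewrite /mxtrace (bigD1 i') //= big1 => [|k nk].
      rewrite mxE eqxx andbT addr0 eq_sym. over.
    by rewrite mxE (negbTE nk) andbF.
  by rewrite sumr_const mulr_natl.
rewrite Sa mxtrace_scalar in trS; rewrite Sa mxE mulr_natl mulrnAC trS.
by case: (i == j'); rewrite /= ?mulr0n ?mulr1n ?mulr0.
Qed.

(** * Minors of signed permutation matrices *)

Section IncrVal.
Variables d m : nat.
Implicit Types i j : 'I_#|incr_tuples m d|.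

Definition incr_val i : m.-tuple 'I_d := enum_val i.

Lemma incr_val_uniq i : uniq (incr_val i).
Proof. by apply/tuple_uniqP; apply: incr_tuple_inj; exact: enum_valP. Qed.

Lemma incr_val_perm i j : perm_eq (incr_val i) (incr_val j) -> i = j.
Proof. by move=> ij; apply/enum_val_inj/incr_tuple_perm; rewrite ?enum_valP. Qed.

Lemma ext_mxE (C : comUnitRingType) (A : 'M[C]_d) i j :
  ext_mx m A i j = \det (mxsub (tnth (incr_val i)) (tnth (incr_val j)) A).
Proof.
by rewrite !mxE; congr (\det _); apply/matrixP => a b; rewrite !mxE.
Qed.

End IncrVal.

Lemma ext_mx_tr (C : comUnitRingType) d m (A : 'M[C]_d) :
  ext_mx m A^T = (ext_mx m A)^T.
Proof.
apply/matrixP => i j; rewrite !mxE -[in RHS]det_tr; congr (\det _).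
by apply/matrixP => a b; rewrite !mxE.
Qed.

Lemma map_ext_mx (C C' : comUnitRingType) (f : {rmorphism C -> C'}) d m
    (A : 'M[C]_d) :
  ext_mx m (map_mx f A) = map_mx f (ext_mx m A).
Proof.
apply/matrixP => i j; rewrite !mxE -det_map_mx; congr (\det _).
by apply/matrixP => a b; rewrite !mxE.
Qed.

Section SignedPermutations.
Variables (C : comUnitRingType) (d : nat).
Implicit Types (m : nat) (s t : 'S_d).

Local Notation sperm := ('S_d * {ffun 'I_d -> bool})%type.

(** The transpose of this matrix is its inverse, so it is the counterpart of [rG g^-1%g] below. *)
Definition sperm_mx (k : sperm) : 'M[C]_d :=
  \matrix_(i, j) ((-1) ^+ k.2 i * (k.1 i == j)%:R).

Local Notation extp m s := (ext_mx m (perm_mx s : 'M[C]_d)).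

Lemma extpM m s t : extp m (s * t)%g = extp m s *m extp m t.
Proof. by rewrite perm_mxM ext_mxM. Qed.

(** A nonzero minor has a nonzero term in its expansion, which matches the image of the row set with
    the column set. *)
Lemma ext_perm_neq0 m s i j :
  extp m s i j != 0 -> perm_eq (map s (incr_val i)) (incr_val j).
Proof.
rewrite ext_mxE; set A := mxsub _ _ _ => nz.
have /existsP[p /forallP hp] : [exists p : 'S_m,
    [forall l, s (tnth (incr_val i) l) == tnth (incr_val j) (p l)]].
  apply: contraNT nz => /existsPn h; apply/eqP/big1 => p _.
  have /forallPn[l hl] := h p.
  by rewrite (bigD1 l) //= !mxE (negbTE hl) mul0r mulr0.
apply/tuple_permP; exists p; rewrite -[map _ _]/(val [tuple of map s (incr_val i)]).
by congr val; apply: eq_from_tnth => l; rewrite tnth_map tnth_mktuple (eqP (hp l)).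
Qed.

Lemma ext_perm_col_uniq m s i j j' :
  extp m s i j != 0 -> extp m s i j' != 0 -> j = j'.
Proof.
move=> /ext_perm_neq0 h /ext_perm_neq0; rewrite (perm_sym _ (incr_val j')).
rewrite perm_sym in h => h'; apply: incr_val_perm.
by apply: perm_trans h _; rewrite perm_sym.
Qed.

(** The permutation carries one subset to the other in increasing order, so the minor is that of an
    identity matrix and no sign appears. *)
Lemma ext_perm_transitive m (j j' : 'I_#|incr_tuples m d|) :
  exists s, forall i, extp m s i j' = (i == j)%:R.
Proof.
(* All of ['I_d] is listed with the members of [k] first; the permutation sought matches the list of
   [j] with that of [j']. *)
pose q (k : 'I_#|incr_tuples m d|) : seq 'I_d :=
  incr_val k ++ [seq x <- enum 'I_d | x \notin incr_val k].
have uq k : uniq (q k).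
  rewrite cat_uniq incr_val_uniq filter_uniq ?enum_uniq // andbT.
  by apply/hasPn => x; rewrite mem_filter => /andP[].
have mq k x : x \in q k.
  by rewrite mem_cat mem_filter mem_enum andbT orbN.
have szq k : size (q k) = d.
  rewrite -[RHS](card_ord d) cardE; apply/perm_size/uniq_perm; rewrite ?uq ?enum_uniq //.
  by move=> x; rewrite mq mem_enum.
have injq k : injective (fun l : 'I_d => nth l (q k) l).
  move=> a b /eqP; rewrite (set_nth_default b) ?szq ?ltn_ord //.
  by rewrite nth_uniq ?szq ?ltn_ord // => /eqP/val_inj.
pose p k := perm (injq k).
have md : (m <= d)%N.
  by have := max_card (mem (incr_val j));
    rewrite (card_uniqP (incr_val_uniq j)) size_tuple card_ord.
have pE k l : p k (widen_ord md l) = tnth (incr_val k) l.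
  by rewrite permE nth_cat size_tuple /= ltn_ord -tnth_nth.
pose s := ((p j)^-1 * p j')%g.
have sE l : s (tnth (incr_val j) l) = tnth (incr_val j') l.
  by rewrite -pE permM permK pE.
have s1 : extp m s j j' = 1.
  rewrite ext_mxE -[RHS](det1 C m); congr (\det _); apply/matrixP => a b.
  by rewrite !mxE sE (inj_eq (tuple_uniqP _ (incr_val_uniq j'))).
exists s => i; have [->//|nij] := eqVneq i j.
apply/eqP; apply: contraNT nij => /ext_perm_neq0 hi; apply/eqP.
have := ext_perm_neq0 (_ : extp m s j j' != 0).
rewrite s1 oner_eq0 perm_sym => /(_ isT) hj.
apply: incr_val_perm.
apply: (perm_map_inj (@perm_inj _ s)); exact: perm_trans hi hj.
Qed.

(** By transitivity the sum does not depend on the column. Over all columns, the squares in row [i]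
    add up to 1 for each permutation, because [extp m s] is orthogonal. *)
Lemma sum_ext_perm_sqr m (i j : 'I_#|incr_tuples m d|) :
  #|incr_tuples m d|%:R * \sum_s extp m s i j ^+ 2 = d`!%:R.
Proof.
have indep j' : \sum_s extp m s i j' ^+ 2 = \sum_s extp m s i j ^+ 2.
  have [t tE] := ext_perm_transitive j j'.
  rewrite (reindex_inj (mulIg t)) /=; apply: eq_bigr => s _; congr (_ ^+ 2).
  rewrite extpM mxE (bigD1 j) //= tE eqxx mulr1 big1 ?addr0 // => k nkj.
  by rewrite tE (negbTE nkj) mulr0.
transitivity (\sum_j' \sum_s extp m s i j' ^+ 2).
  by rewrite (eq_bigr _ (fun j' _ => indep j')) sumr_const card_ord mulr_natl.
rewrite exchange_big /=; transitivity (\sum_(s : 'S_d) (1 : C)); last first.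
  by rewrite sumr_const card_Sn.
apply: eq_bigr => s _.
transitivity ((extp m s *m (extp m s)^T) i i).
  rewrite [RHS]mxE; apply: eq_bigr => j' _.
  by rewrite [X in _ = _ * X]mxE expr2.
rewrite -ext_mx_tr -ext_mxM tr_perm_mx -perm_mxM mulgV perm_mx1 ext_mx1.
by rewrite mxE eqxx.
Qed.

Lemma ext_sperm m (k : sperm) i j :
  ext_mx m (sperm_mx k) i j =
  (\prod_(a in incr_val i) (-1) ^+ k.2 a) * extp m k.1 i j.
Proof.
rewrite !ext_mxE; set D := \row_l (-1) ^+ k.2 (tnth (incr_val i) l) : 'rV[C]_m.
set A := mxsub _ _ (perm_mx k.1).
have -> : mxsub (tnth (incr_val i)) (tnth (incr_val j)) (sperm_mx k) =
    diag_mx D *m A.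
  by rewrite mul_diag_mx; apply/matrixP => a b; rewrite !mxE.
rewrite det_mulmx det_diag; congr (_ * _).
rewrite -(big_uniq _ (incr_val_uniq i)) /= big_tuple.
by apply: eq_bigr => l _; rewrite mxE.
Qed.

(** Orthogonality of the characters of the group of sign vectors: the sum factors over coordinates,
    and one lying in exactly one of [S], [T] contributes [1 - 1]. *)
Lemma sum_sign_prod (S T : {pred 'I_d}) :
  \sum_(e : {ffun 'I_d -> bool})
     (\prod_(a in S) (-1) ^+ e a) * (\prod_(a in T) (-1) ^+ e a) =
  if [forall a, (a \in S) == (a \in T)] then 2 ^+ d else 0 :> C.
Proof.
pose F a (b : bool) : C :=
  (if a \in S then (-1) ^+ b else 1) * (if a \in T then (-1) ^+ b else 1).
transitivity (\sum_(e : {ffun 'I_d -> bool}) \prod_a F a (e a)).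
  apply: eq_bigr => e _; rewrite big_mkcond [X in _ * X]big_mkcond.
  by rewrite -big_split.
rewrite -bigA_distr_bigA.
under eq_bigr => a _ do rewrite big_bool /F /=.
case: forallP => [eST | /forallP/forallPn[a nST]].
  rewrite -[d in RHS]card_ord -prodr_const; apply: eq_bigr => a _.
  by rewrite (eqP (eST a)); case: (a \in T); rewrite ?expr0 ?expr1; ring.
rewrite (bigD1 a) //=; move: nST.
by case: (a \in S); case: (a \in T) => // _;
  rewrite ?expr0 ?expr1 mulr1 ?mul1r ?addNr ?mul0r.
Qed.

(** Transposition exchanges [i'] and [j'], so the signs are those of the rows [i] and [j'], and they
    separate from the permutation. *)
Lemma sum_ext_sperm m m' i j i' j' :
  \sum_k ext_mx m (sperm_mx k) i j * ext_mx m' (sperm_mx k)^T i' j' =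
  (\sum_s extp m s i j * extp m' s j' i') *
  (\sum_(e : {ffun 'I_d -> bool})
     (\prod_(a in incr_val i) (-1) ^+ e a) *
     (\prod_(a in incr_val j') (-1) ^+ e a)).
Proof.
rewrite big_distrlr /= pair_bigA /=; apply: eq_bigr => k _.
by rewrite ext_mx_tr [X in _ * X]mxE !ext_sperm; ring.
Qed.

Lemma sperm_orthogonality_neq m m' i j i' j' : m != m' ->
  \sum_k ext_mx m (sperm_mx k) i j * ext_mx m' (sperm_mx k)^T i' j' = 0.
Proof.
move=> nmm; rewrite sum_ext_sperm sum_sign_prod.
case: forallP => [e|_]; last by rewrite mulr0.
case/eqP: nmm; rewrite -(size_tuple (incr_val i)) -(size_tuple (incr_val j')).
apply/perm_size/uniq_perm; rewrite ?incr_val_uniq // => a.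
exact/eqP/e.
Qed.

(** The same relation as Schur orthogonality, obtained directly: the signs force [i = j'], and then
    a permutation admits only one column with a nonzero minor. *)
Lemma sperm_orthogonality m i j i' j' :
  #|incr_tuples m d|%:R *
    \sum_k ext_mx m (sperm_mx k) i j * ext_mx m (sperm_mx k)^T i' j' =
  #|{: sperm}|%:R * ((i == j') && (j == i'))%:R.
Proof.
rewrite sum_ext_sperm sum_sign_prod.
have [<-|nij] := eqVneq i j'; last first.
  case: forallP => [e|_]; last by rewrite !mulr0.
  case/eqP: nij; apply/incr_val_perm/uniq_perm; rewrite ?incr_val_uniq // => a.
  exact/eqP/e.
have -> : [forall a, (a \in incr_val i) == (a \in incr_val i)] by apply/forallP.
rewrite /=; have [<-|njj] := eqVneq j i'.
  rewrite mulr1 mulrA; under eq_bigr => s _ do rewrite -expr2.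
  rewrite sum_ext_perm_sqr card_prod card_Sn card_ffun card_bool card_ord.
  by rewrite natrM natrX.
rewrite mulr0 big1 ?mul0r ?mulr0 // => s _.
apply/eqP; apply: contraNT njj => nz; apply/eqP/(@ext_perm_col_uniq _ s i).
  by apply: contraNneq nz => ->; rewrite mul0r.
by apply: contraNneq nz => ->; rewrite mulr0.
Qed.

End SignedPermutations.

Lemma incr_val_leq d m (i : 'I_#|incr_tuples m d|) : (m <= d)%N.
Proof.
have := max_card (mem (incr_val i)).
by rewrite (card_uniqP (incr_val_uniq i)) size_tuple card_ord.
Qed.

(** * Averaging over the label of one edge *)

Section OneEdge.
Variables (C : numClosedFieldType) (gT : finGroupType) (d : nat).
Variable rG : mx_representation C [set: gT]%G d.
Hypothesis irrG : ext_powers_irr_distinct rG.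

(** Both averages obey the same orthogonality relations, and the common dimension
    [#|incr_tuples m d|] can be cancelled in characteristic zero. *)
Lemma avg_ext_mx_eq m m' i j i' j' :
  #|gT|%:R^-1 * \sum_g ext_mx m (rG g) i j * ext_mx m' (rG g^-1%g) i' j' =
  #|{: 'S_d * {ffun 'I_d -> bool}}|%:R^-1 *
    \sum_k ext_mx m (sperm_mx C k) i j * ext_mx m' (sperm_mx C k)^T i' j'.
Proof.
have card_neq0 (T : finType) (x : T) : #|T|%:R != 0 :> C.
  by rewrite pnatr_eq0 -lt0n; apply/card_gt0P; exists x.
have md := incr_val_leq i; have md' := incr_val_leq i'.
rewrite -sum_setT; have [emm|nmm] := eqVneq m m'; last first.
  rewrite sperm_orthogonality_neq // mulr0.
  rewrite (@schur_orthogonality_nonsim _ _ _ _ _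
    (ext_repr rG m) (ext_repr rG m')) ?mulr0 //.
  - exact: irrG.1.
  - exact: irrG.1.
  - by apply: irrG.2 => //; apply/eqP.
subst m'; have n_neq0 : #|incr_tuples m d|%:R != 0 :> C.
  by rewrite -[X in X%:R]card_ord (card_neq0 _ i).
apply: (mulfI n_neq0); rewrite mulrCA [RHS]mulrCA sperm_orthogonality.
rewrite (schur_orthogonality i j i' j' (irrG.1 m md)) cardsT.
rewrite !mulKf //; first exact: (card_neq0 _ (1%g, [ffun=> false])).
exact: (card_neq0 _ 1%g).
Qed.

Lemma avg_det_eq n (B : 'M[{poly C}]_n) (U W : 'M_(n, d)) (V Z : 'M_(d, n)) :
  (#|gT|%:R^-1)%:P *
    \sum_g \det (B + U *m map_mx polyC (rG g) *m V
                   + W *m map_mx polyC (rG g^-1%g) *m Z) =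
  (#|{: 'S_d * {ffun 'I_d -> bool}}|%:R^-1)%:P *
    \sum_k \det (B + U *m map_mx polyC (sperm_mx C k) *m V
                   + W *m map_mx polyC (sperm_mx C k)^T *m Z).
Proof.
(* Both laws live on a disjoint union, with weights of opposite signs, so that the equality becomes
   a vanishing weighted sum. *)
pose K := (gT + 'S_d * {ffun 'I_d -> bool})%type.
pose P (k : K) := match k with inl g => rG g | inr s => sperm_mx C s end.
pose Q (k : K) := match k with inl g => rG g^-1%g | inr s => (sperm_mx C s)^T end.
pose w (k : K) : C := match k with
  | inl g => #|gT|%:R^-1
  | inr s => - #|{: 'S_d * {ffun 'I_d -> bool}}|%:R^-1 end.
have := @ext_null_det2 {poly C} d K (polyC \o w) (map_mx polyC \o P)
  (map_mx polyC \o Q) _ n B U W V Z.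
rewrite big_sumType /= -!big_distrr /= polyCN mulNr => H.
apply/eqP; rewrite -subr_eq0; apply/eqP/H => m m' i j i' j'.
under eq_bigr => k _ do
  rewrite /= !map_ext_mx [X in _ * (X * _)]mxE [X in _ * (_ * X)]mxE -!polyCM.
rewrite -rmorph_sum /= big_sumType /= -!big_distrr /= mulNr avg_ext_mx_eq.
by rewrite subrr.
Qed.

End OneEdge.

(** * Changing the law of independent labels *)

Section Resampling.
Variables (E K : finType).

Definition ffun_upd (f : {ffun E -> K}) e k : {ffun E -> K} :=
  [ffun a => if a == e then k else f a].

(** Exchanging the new value with the old one is an involution on pairs, and it turns the updated
    function into an arbitrary one. *)
Lemma sum_ffun_upd (V : nmodType) (F : {ffun E -> K} -> V) e :
  \sum_k \sum_f F (ffun_upd f e k) = (\sum_f F f) *+ #|K|.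
Proof.
rewrite pair_bigA /=.
pose h (p : K * {ffun E -> K}) := (p.2 e, ffun_upd p.2 e p.1).
have hK : involutive h.
  case=> k f; rewrite /h /= ffunE eqxx; congr (_, _).
  by apply/ffunP => a; rewrite !ffunE; case: eqP => [->|].
rewrite (reindex_inj (inv_inj hK)) /=.
rewrite (eq_bigr (fun p : K * {ffun E -> K} => F p.2)) => [|[k f] _]; last first.
  by congr F; have [_ ->] := hK (k, f).
by rewrite -(pair_bigA _ (fun _ f => F f)) /= sumr_const.
Qed.

Variables (C : comPzRingType) (V : nmodType) (F : V -> C) (X : E -> K -> V).

(** The value at [e] is drawn separately as [k], while [f] stays a function on all of [E], which
    keeps its type fixed for an induction on [A]; [c] compensates for the extra summation. *)
Lemma sum_ffun_setU1 c (cK : c * #|K|%:R = 1) (A : {set E}) e B : e \notin A ->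
  \sum_(f : {ffun E -> K}) F (B + \sum_(a in e |: A) X a (f a)) =
  c * \sum_k \sum_(f : {ffun E -> K}) F (B + X e k + \sum_(a in A) X a (f a)).
Proof.
move=> eA; pose G (f : {ffun E -> K}) := F (B + \sum_(a in e |: A) X a (f a)).
transitivity (c * \sum_k \sum_f G (ffun_upd f e k)).
  by rewrite sum_ffun_upd -mulr_natl mulrA cK mul1r.
congr (_ * _); apply: eq_bigr => k _; apply: eq_bigr => f _.
rewrite /G big_setU1 //= addrA ffunE eqxx; congr (F (_ + _)).
apply: eq_bigr => a aA; rewrite ffunE; case: eqP => // ae.
by rewrite -ae aA in eA.
Qed.

Lemma avg_ffun_set0 c (cK : c * #|K|%:R = 1) B :
  c ^+ #|E| * \sum_(f : {ffun E -> K}) F (B + \sum_(a in set0) X a (f a)) = F B.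
Proof.
under eq_bigr => f _ do rewrite big_set0 addr0.
by rewrite sumr_const card_ffun -mulr_natl natrX mulrA -exprMn cK expr1n mul1r.
Qed.

End Resampling.

Lemma set_ind (E : finType) (P : {set E} -> Prop) :
  P set0 -> (forall e (A : {set E}), e \notin A -> P A -> P (e |: A)) -> forall A, P A.
Proof.
move=> P0 PU A; have [n] := ubnP #|A|; elim: n A => // n IHn A.
have [->//|[e eA]] := set_0Vmem A; rewrite ltnS => cA.
rewrite -(setD1K eA); apply: PU; first by rewrite !inE eqxx.
by apply: IHn; apply: leq_trans cA; rewrite [X in (_ < X)%N](cardsD1 e) eA.
Qed.

(* Changes the law of one coordinate at a time. *)
Lemma avg_ffun_eq (E K1 K2 : finType) (C : comPzRingType) (V : nmodType)
    (F : V -> C) (X1 : E -> K1 -> V) (X2 : E -> K2 -> V) c1 c2 :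
  c1 * #|K1|%:R = 1 -> c2 * #|K2|%:R = 1 ->
  (forall e B, c1 * \sum_k F (B + X1 e k) = c2 * \sum_k F (B + X2 e k)) ->
  forall (A : {set E}) B,
  c1 ^+ #|E| * \sum_(f : {ffun E -> K1}) F (B + \sum_(a in A) X1 a (f a)) =
  c2 ^+ #|E| * \sum_(f : {ffun E -> K2}) F (B + \sum_(a in A) X2 a (f a)).
Proof.
move=> cK1 cK2 eX; apply: set_ind => [B|e A eA IH B].
  by rewrite (avg_ffun_set0 F X1 cK1) (avg_ffun_set0 F X2 cK2).
rewrite (sum_ffun_setU1 F X1 cK1 _ eA) (sum_ffun_setU1 F X2 cK2 _ eA).
rewrite exchange_big /= big_distrr /=.
(* For fixed [f] the terms of [A] are absorbed into the base point, and only the law at [e]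
   changes. *)
have swap (f : {ffun E -> K1}) :
    c1 * \sum_k F (B + X1 e k + \sum_(a in A) X1 a (f a)) =
    c2 * \sum_k F (B + X2 e k + \sum_(a in A) X1 a (f a)).
  have := eX e (B + \sum_(a in A) X1 a (f a)).
  by do 2![under eq_bigr => k _ do rewrite addrAC] => ->;
    congr (_ * _); apply: eq_bigr => k _; rewrite addrAC.
under eq_bigr => f _ do rewrite swap.
rewrite -big_distrr /= exchange_big /= mulrCA [RHS]mulrCA; congr (_ * _).
by rewrite !big_distrr /=; apply: eq_bigr => k _; exact: IH.
Qed.

(** * The Godsil-Gutman formula *)

Section RowReplacement.
Variables (C : comNzRingType) (n : nat).
Implicit Types (A B : 'M[C]_n) (W : {set 'I_n}) (u v : 'I_n).

Definition repl_row A u (r : 'I_n -> C) : 'M[C]_n :=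
  \matrix_(i, j) if i == u then r j else A i j.

Lemma det_repl_rowD A u c (r : 'I_n -> C) :
  \det (repl_row A u (fun j => A u j + c * r j)) =
  \det A + c * \det (repl_row A u r).
Proof.
rewrite (determinant_multilinear (B := A) (C := repl_row A u r) (i0 := u)
  (b := 1) (c := c)).
- by rewrite mul1r.
- by apply/rowP => j; rewrite !mxE eqxx mul1r.
- by apply/matrixP => i j; rewrite !mxE eq_sym (negbTE (neq_lift _ _)).
- by apply/matrixP => i j; rewrite !mxE eq_sym (negbTE (neq_lift _ _)).
Qed.

(* The determinant of [del_mx B W] is the principal minor of [B] obtained by
   deleting the rows and columns in [W]. *)
Definition del_mx B W : 'M[C]_n :=
  \matrix_(i, j) if i \in W then (i == j)%:R else B i j.

Definition edge_mx u v : 'M[C]_n := delta_mx u v + delta_mx v u.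

Lemma edge_mxC u v : edge_mx u v = edge_mx v u.
Proof. exact: addrC. Qed.

(** A sign that enters a single row linearly cancels between its two values. *)
Lemma det_pm_row A u (r : 'I_n -> C) (X : C -> 'M[C]_n) :
  (forall c, X c = repl_row A u (fun j => A u j + c * r j)) ->
  \det (X (-1)) + \det (X 1) = 2 * \det A.
Proof. by move=> XE; rewrite !XE !det_repl_rowD; ring. Qed.

(** Row [u] is frozen by the deletion, so the sign can enter only row [v], and not even that one if
    [v] lies in [W]. *)
Lemma det_pm_edge_mem B W u v : u \in W ->
  \det (del_mx (B + (-1) *: edge_mx u v) W) +
    \det (del_mx (B + 1 *: edge_mx u v) W) = 2 * \det (del_mx B W).
Proof.
move=> uW; pose r j : C := if v \in W then 0 else (u == j)%:R.
apply: (@det_pm_row _ v r (fun c => del_mx (B + c *: edge_mx u v) W)) => c.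
apply/matrixP => i j; rewrite !mxE /r.
have [->|niv] := eqVneq i v.
  case: ifP => vW; first by rewrite mulr0 addr0.
  have /negbTE-> /= : v != u by apply: contraFneq vW => ->.
  by rewrite add0r eq_sym.
have [->|niu] := eqVneq i u; first by rewrite uW.
by rewrite !andFb addr0 mulr0 addr0.
Qed.

Lemma det_pm_edge_loop B W u :
  \det (del_mx (B + (-1) *: edge_mx u u) W) +
    \det (del_mx (B + 1 *: edge_mx u u) W) = 2 * \det (del_mx B W).
Proof.
case uW: (u \in W); first exact: det_pm_edge_mem.
pose r j : C := (u == j)%:R *+ 2.
apply: (@det_pm_row _ u r (fun c => del_mx (B + c *: edge_mx u u) W)) => c.
apply/matrixP => i j; rewrite !mxE /r.
have [->|niu] := eqVneq i u; first by rewrite uW eq_sym mulr2n.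
by rewrite /= addr0 mulr0 addr0.
Qed.

(** The sign [c] enters rows [u] and [v]. The terms linear in [c] cancel; the quadratic one survives
    and, after a transposition of the two rows, is minus the minor without [u] and [v]. *)
Lemma det_pm_edge_notin B W u v : u != v -> u \notin W -> v \notin W ->
  \det (del_mx (B + (-1) *: edge_mx u v) W) +
    \det (del_mx (B + 1 *: edge_mx u v) W) =
  2 * (\det (del_mx B W) - \det (del_mx B ([set u; v] :|: W))).
Proof.
move=> nuv /negbTE uW /negbTE vW; set A := del_mx B W.
have nvu : v != u by rewrite eq_sym.
pose eu j : C := (u == j)%:R; pose ev j : C := (v == j)%:R.
pose A1 c := repl_row A u (fun j => A u j + c * ev j).
have E c : \det (del_mx (B + c *: edge_mx u v) W) =
    \det A + c * \det (repl_row A u ev) + c * (\det (repl_row A v eu) +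
       c * \det (repl_row (repl_row A v eu) u ev)).
  have -> : del_mx (B + c *: edge_mx u v) W =
      repl_row (A1 c) v (fun j => A1 c v j + c * eu j).
    apply/matrixP => i j; rewrite !mxE /eu /ev.
    have [->|niv] := eqVneq i v.
      by rewrite vW (negbTE nvu) /= add0r [j == u]eq_sym.
    have [->|niu] := eqVneq i u; first by rewrite uW /= addr0 [j == v]eq_sym.
    by rewrite /= addr0 mulr0 addr0.
  rewrite det_repl_rowD det_repl_rowD; congr (_ + _ * _).
  rewrite -det_repl_rowD; congr (\det _); apply/matrixP => i j; rewrite !mxE.
  have [->|niv] := eqVneq i v; first by rewrite (negbTE nvu).
  by rewrite (negbTE nuv).
rewrite !E.
have -> : \det (del_mx B ([set u; v] :|: W)) =
    - \det (repl_row (repl_row A v eu) u ev).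
  rewrite -[RHS]mulN1r -[X in X * _](_ : (-1) ^+ tperm u v = -1); last first.
    by rewrite odd_tperm nuv.
  rewrite -det_perm -det_mulmx -row_permE; congr (\det _).
  apply/matrixP => i j; rewrite !mxE !inE /eu /ev.
  have [->|niv] := eqVneq i v.
    by rewrite tpermR eqxx orbT.
  have [->|niu] := eqVneq i u.
    by rewrite tpermL (negbTE nvu) eqxx.
  by rewrite tpermD 1?eq_sym // (negbTE niu) (negbTE niv).
by ring.
Qed.

End RowReplacement.

Section GodsilGutman.
Variables (C : comNzRingType) (H : multigraph) (n : nat).
Variable b : vertex H -> 'I_n.
Hypothesis b_inj : injective b.
Implicit Types (e f : edge H) (M A : {set edge H}) (B : 'M[C]_n).

Local Notation u e := (b (etail e)).
Local Notation v e := (b (ehead e)).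

Definition covered M : {set 'I_n} := \bigcup_(e in M) [set u e; v e].

Lemma disjoint_edge_ends e f :
  [disjoint edge_ends e & edge_ends f] =
  (u e \notin [set u f; v f]) && (v e \notin [set u f; v f]).
Proof.
rewrite /edge_ends disjoints_subset subUset !sub1set !inE.
by rewrite !(inj_eq b_inj).
Qed.

Lemma is_matchingU1 e M : e \notin M ->
  is_matching (e |: M) =
  is_matching M && [&& u e != v e, u e \notin covered M & v e \notin covered M].
Proof.
move=> eM.
have neM f : f \in M -> e != f by move=> fM; apply: contraNneq eM => ->.
apply/andP/and4P => [[/forall_inP loop /forall_inP disj]|].
  have eU : e \in e |: M by rewrite setU11.
  have dis f : f \in M -> (u e \notin [set u f; v f]) && (v e \notin [set u f; v f]).
    move=> fM; rewrite -disjoint_edge_ends.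
    have /forall_inP/(_ f) := disj e eU.
    by rewrite setU1r // neM // => /(_ isT).
  split.
  - apply/andP; split; apply/forall_inP => f fM; first by apply: loop; rewrite setU1r.
    have /forall_inP hf := disj f (setU1r _ fM).
    by apply/forall_inP => g gM; apply: hf; rewrite setU1r.
  - by rewrite (inj_eq b_inj); apply: loop.
  - by apply/bigcupP => -[f /dis/andP[/negbTE->]].
  - by apply/bigcupP => -[f /dis/andP[_ /negbTE->]].
case=> /andP[/forall_inP loop /forall_inP disj] nuv nu nv.
have dis f : f \in M -> [disjoint edge_ends e & edge_ends f].
  move=> fM; rewrite disjoint_edge_ends.
  by apply/andP; split; [apply: contra nu | apply: contra nv] => h;
    apply/bigcupP; exists f.
split; apply/forall_inP => f /setU1P[->|fM].
- by rewrite -(inj_eq b_inj).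
- exact: loop.
- apply/forall_inP => g /setU1P[->|gM]; first by rewrite eqxx.
  by rewrite dis // implybT.
apply/forall_inP => g /setU1P[->|gM]; last first.
  by have /forall_inP := disj f fM; apply.
by rewrite disjoint_sym dis // implybT.
Qed.

Lemma card_covered M : is_matching M -> #|covered M| = #|M|.*2.
Proof.
elim/set_ind: M => [|e M eM IH]; first by rewrite /covered big_set0 !cards0.
rewrite is_matchingU1 // => /andP[/IH cM /and3P[nuv nu nv]].
rewrite cardsU1 eM /covered big_setU1 //= cardsU cards2 nuv -/(covered M) cM.
rewrite (_ : _ :&: _ = set0) ?cards0 ?subn0 //.
apply/setP => x; rewrite !inE; case: eqP => [->|_]; first by rewrite (negbTE nu).
by case: eqP => [->|_] //=; rewrite (negbTE nv).
Qed.

Lemma sum_matchingsU1 e A (F : {set edge H} -> C) : e \notin A ->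
  \sum_(M : {set edge H} | (M \subset e |: A) && is_matching M) F M =
  \sum_(M : {set edge H} | (M \subset A) && is_matching M)
    (F M + if [&& u e != v e, u e \notin covered M & v e \notin covered M]
           then F (e |: M) else 0).
Proof.
move=> eA; have eM M : M \subset A -> e \notin M.
  by move=> sM; apply: contra eA; apply/subsetP.
rewrite big_split /= (bigID (fun M => e \in M)) /= addrC; congr (_ + _).
  apply: eq_bigl => M; apply/idP/idP => [/andP[/andP[sM ->] eM']|/andP[sM ->]].
    by rewrite andbT -(setU1K eA) subsetD1 sM.
  by rewrite (subset_trans sM (subsetUr _ _)) eM.
rewrite -big_mkcondr /=.
rewrite (reindex_onto (fun M => e |: M) (fun M => M :\ e)) /=; last first.
  by move=> M /andP[_ eM']; rewrite setD1K.
apply: eq_bigl => M; rewrite setU11 andbT.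
have [eM'|neM] := boolP (e \in M).
  rewrite [X in _ && X](_ : _ = false) ?andbF; last first.
    by apply/eqP => /setP/(_ e); rewrite !inE eqxx eM'.
  by apply/esym/negbTE; apply/negP => /andP[/andP[/eM]]; rewrite eM'.
rewrite setU1K // eqxx andbT is_matchingU1 // andbA; congr (_ && _ && _).
by rewrite -{2}(setU1K eA) subsetD1 neM andbT subUset sub1set setU11.
Qed.

Variable h : C.
Hypothesis h2 : h * 2 = 1.

(** The outer minus sign is that of the adjacency matrix in [xI - A]. *)
Definition signed_edge e (s : bool) : 'M[C]_n :=
  (- (-1) ^+ s) *: edge_mx C (u e) (v e).

(* The sign of an edge outside the matched part averages out, unless it is used
   twice, as a transposition of its two ends. *)
Lemma avg_signed_det A B :
  h ^+ #|edge H| * \sum_(s : {ffun edge H -> bool})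
     \det (B + \sum_(e in A) signed_edge e (s e)) =
  \sum_(M : {set edge H} | (M \subset A) && is_matching M)
     (-1) ^+ #|M| * \det (del_mx B (covered M)).
Proof.
have hb : h * #|{: bool}|%:R = 1 by rewrite card_bool.
have half x y : h * (x * (2 * y)) = x * y.
  by transitivity ((h * 2) * (x * y)); [ring | rewrite h2 mul1r].
elim/set_ind: A B => [B|e A eA IH B].
  rewrite (avg_ffun_set0 (fun X : 'M[C]_n => \det X) signed_edge hb).
  rewrite (bigD1 set0) /=; last first.
    by rewrite sub0set /=; apply/andP; split; apply/forall_inP => f; rewrite inE.
  rewrite cards0 expr0 mul1r big1 ?addr0 => [|M /andP[/andP[]]]; last first.
    by rewrite subset0 => /eqP->; rewrite eqxx.
  congr (\det _); apply/matrixP => i j; rewrite !mxE /covered big_set0.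
  by rewrite inE.
rewrite (sum_ffun_setU1 (fun X : 'M[C]_n => \det X) signed_edge hb B eA).
(* The term of [e] joins the base point of the induction hypothesis; it remains to add the two signs
   for each matching [M] of [A]. *)
rewrite mulrCA big_distrr /=; under eq_bigr => k _ do rewrite IH.
rewrite exchange_big big_distrr /= sum_matchingsU1 //.
apply: eq_bigr => M /andP[sM _]; rewrite big_bool /= /signed_edge.
rewrite expr0 expr1 opprK addrC -mulrDr.
have eM : e \notin M by apply: contra eA; apply/subsetP.
(* If [e] extends [M], the transposition term accounts for [e |: M]. Otherwise [e] is a loop or has
   a covered end, and its sign cancels. *)
case: ifP => [/and3P[nuv nu nv]|nuv].
  rewrite det_pm_edge_notin // cardsU1 eM /covered big_setU1 //= exprS.
  by rewrite half; ring.
rewrite addr0 -[RHS]half; congr (_ * (_ * _)).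
have [->|neq] := eqVneq (u e) (v e); first by rewrite det_pm_edge_loop.
have [uM|nuM] := boolP (u e \in covered M); first by rewrite det_pm_edge_mem.
have [vM|nvM] := boolP (v e \in covered M).
  by rewrite edge_mxC det_pm_edge_mem.
by rewrite neq nuM nvM in nuv.
Qed.

End GodsilGutman.

Lemma det_del_scalar (C : comNzRingType) n (W : {set 'I_n}) (x : C) :
  \det (del_mx x%:M W) = x ^+ (n - #|W|).
Proof.
have -> : del_mx x%:M W = diag_mx (\row_i if i \in W then 1 else x).
  apply/matrixP => i j; rewrite !mxE; case: eqP => [->|_]; case: ifP => //.
have -> : (n - #|W|)%N = #|~: W| by rewrite [RHS]cardsCs setCK card_ord.
rewrite det_diag -prodr_const [RHS]big_mkcond; apply: eq_bigr => i _.
by rewrite mxE inE; case: ifP.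
Qed.

(** A matching covers [#|M|.*2] vertices, so its size lies in the range of the defining sum, and
    grouping by size recovers the coefficients. *)
Lemma matching_polyE (C : nzRingType) (H : multigraph) n
    (b : vertex H -> 'I_n) : injective b -> #|vertex H| = n ->
  matching_poly H C =
  \sum_(M : {set edge H} | is_matching M) (-1) ^+ #|M| * 'X^(n - #|M|.*2).
Proof.
move=> b_inj cH; have leM (M : {set edge H}) : is_matching M -> (#|M| < (n./2).+1)%N.
  move=> /(card_covered b_inj) cM; rewrite ltnS -[#|M|]doubleK -cM.
  by apply: half_leq; rewrite -[leqRHS]card_ord max_card.
rewrite (partition_big (fun M : {set edge H} => inord #|M| : 'I_(n./2).+1) xpredT) //=.
rewrite /matching_poly cH; apply: eq_bigr => i _.
transitivity (\sum_(M in [set M : {set edge H} | is_matching M & #|M| == i])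
    (-1) ^+ i * 'X^(n - i.*2) : {poly C}).
  rewrite sumr_const -/(nb_matchings H i) mulr_natr -scalerMnl.
  by rewrite -mul_polyC rmorphXn rmorphN1.
apply: eq_big => [M|M]; rewrite inE; last by case/andP => _ /eqP->.
apply: andb_id2l => /leM h; by rewrite -[RHS]val_eqE /= inordK.
Qed.

Lemma matching_poly_avg (C : numFieldType) (H : multigraph) n
    (b : vertex H -> 'I_n) : injective b -> #|vertex H| = n ->
  matching_poly H C =
  (2^-1)%:P ^+ #|edge H| * \sum_(s : {ffun edge H -> bool})
    \det ('X%:M + \sum_e signed_edge {poly C} b e (s e)).
Proof.
move=> b_inj cH; have h2 : (2^-1)%:P * 2 = 1 :> {poly C}.
  by rewrite -polyC_natr -polyCM mulVf ?pnatr_eq0.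
under eq_bigr => s _ do rewrite -sum_setT.
rewrite (avg_signed_det b_inj h2) (matching_polyE C b_inj cH).
apply: eq_big => [M|M mM]; first by rewrite subsetT.
by rewrite det_del_scalar (card_covered b_inj mM).
Qed.

(** * Labelings and coverings *)

Section Labelings.
Variables (G : multigraph) (gT : finGroupType).

Definition labeling_of (f : {ffun edge G -> gT}) : {ffun dart G -> gT} :=
  [ffun x => if x.2 then (f x.1)^-1%g else f x.1].

Lemma labeling_of_inj : injective labeling_of.
Proof.
move=> f g /ffunP fg; apply/ffunP => e.
by have := fg (e, false); rewrite !ffunE.
Qed.

Lemma labelingsE : labelings G gT = labeling_of @: [set: {ffun edge G -> gT}].
Proof.
apply/setP => g; rewrite inE; apply/forallP/imsetP => [gV|[f _ ->] [e b]].
  exists [ffun e => g (e, false)]; first by rewrite inE.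
  apply/ffunP => -[e []]; rewrite !ffunE //=.
  exact/eqP/(gV (e, false)).
by rewrite !ffunE; case: b; rewrite /= ?invgK.
Qed.

(** A labeling is freely determined by its values on the positive darts, loops included, so a
    uniform labeling is a family of independent uniform labels. *)
Lemma expectation_labelings (C : fieldType) (F : {ffun dart G -> gT} -> {poly C}) :
  uniform_expectation (labelings G gT) F =
  (#|gT|%:R^-1)%:P ^+ #|edge G| * \sum_f F (labeling_of f).
Proof.
rewrite /uniform_expectation labelingsE card_imset; last exact: labeling_of_inj.
rewrite big_imset /=; last by move=> f g _ _; exact: labeling_of_inj.
rewrite cardsT card_ffun natrX -exprVn -mul_polyC rmorphXn; congr (_ * _).
by apply: eq_bigl => f; rewrite inE.
Qed.

End Labelings.

(** * Block matrices as sums of edge contributions *)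

Section BlockMatrices.
Variables (C : numFieldType) (G : multigraph) (d : nat).
Local Notation N := (\sum_(i < #|vertex G|) d)%N.

Definition block_coord (s : 'I_N) : vertex G * 'I_d :=
  (enum_val (tagnat.sig1 s), tagnat.sig2 s).

Definition block_index (x : vertex G * 'I_d) : 'I_N :=
  @tagnat.Rank _ (fun=> d) (enum_rank x.1) x.2.

Lemma block_coordK : cancel block_coord block_index.
Proof. by move=> s; rewrite /block_index /= enum_valK tagnat.sig2K. Qed.

Lemma card_block : #|{: vertex G * 'I_d}| = N.
Proof. by rewrite card_prod card_ord sum_nat_const card_ord. Qed.

Lemma block_indexK : cancel block_index block_coord.
Proof.
have coord_bij : bijective block_coord.
  by apply: inj_card_bij (can_inj block_coordK) _; rewrite card_ord -card_block.
exact/(bij_can_sym coord_bij)/block_coordK.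
Qed.

Lemma block_index_inj : injective block_index.
Proof. exact: can_inj block_indexK. Qed.

Lemma eq_block_index s x : (s == block_index x) = (block_coord s == x).
Proof. by rewrite -{1}[s]block_coordK (inj_eq block_index_inj). Qed.

Definition block_incl (v : vertex G) : 'M[{poly C}]_(N, d) :=
  \matrix_(s, i) (block_coord s == (v, i))%:R.

Lemma block_mxE v w (P : 'M[{poly C}]_d) s t :
  (block_incl v *m P *m (block_incl w)^T) s t =
  if ((block_coord s).1 == v) && ((block_coord t).1 == w)
  then P (block_coord s).2 (block_coord t).2 else 0.
Proof.
have sum_incl u r (F : 'I_d -> {poly C}) :
    \sum_i block_incl u r i * F i =
    if (block_coord r).1 == u then F (block_coord r).2 else 0.
  under eq_bigr => i _ do rewrite mxE.
  case: (block_coord r) => a k /=; rewrite (bigD1 k) //= xpair_eqE eqxx andbT.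
  rewrite big1 => [|i nik]; first by rewrite addr0; case: eqP; rewrite ?mul1r ?mul0r.
  by rewrite xpair_eqE [k == i]eq_sym (negbTE nik) andbF mul0r.
rewrite -mulmxA mxE sum_incl; case: ifP => // _.
rewrite mxE; under eq_bigr => k _ do rewrite [X in _ * X]mxE mulrC.
by rewrite sum_incl.
Qed.

(** The contribution of both darts of [e] to [xI - A], in the shape [U P V + W Q Z]; for a loop the
    two terms add up in one diagonal block. *)
Definition edge_block (e : edge G) (P Q : 'M[C]_d) : 'M[{poly C}]_N :=
  - block_incl (etail e) *m map_mx polyC P *m (block_incl (ehead e))^T +
  - block_incl (ehead e) *m map_mx polyC Q *m (block_incl (etail e))^T.

Lemma edge_blockE e P Q s t :
  edge_block e P Q s t =
  - ((if ((block_coord s).1 == etail e) && ((block_coord t).1 == ehead e)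
      then P (block_coord s).2 (block_coord t).2 else 0) +
     (if ((block_coord s).1 == ehead e) && ((block_coord t).1 == etail e)
      then Q (block_coord s).2 (block_coord t).2 else 0))%:P.
Proof.
rewrite /edge_block !mulNmx -opprD [LHS]mxE [X in - X]mxE !block_mxE polyCD.
by congr (- (_ + _)); case: ifP; rewrite ?mxE.
Qed.

Lemma labeled_char_polyE (gT : finGroupType)
    (rG : mx_representation C [set: gT]%G d) (f : {ffun edge G -> gT}) :
  labeled_char_poly rG (labeling_of f) =
  \det ('X%:M + \sum_e edge_block e (rG (f e)) (rG (f e)^-1%g)).
Proof.
rewrite /labeled_char_poly /char_poly /char_poly_mx; congr (\det (_ + _)).
apply/matrixP => s t; rewrite [LHS]mxE [X in - X]mxE summxE.
under [RHS]eq_bigr => e _ do rewrite edge_blockE.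
rewrite sumrN -rmorph_sum; congr (- _%:P).
transitivity (\sum_(e : edge G) \sum_(b : bool)
    if (dtail (e, b) == (block_coord s).1) && (dhead (e, b) == (block_coord t).1)
    then rG (labeling_of f (e, b)) (block_coord s).2 (block_coord t).2 else 0).
  rewrite pair_bigA /labeled_adj mxE summxE big_mkcond.
  by apply: eq_bigr => -[e b].
apply: eq_bigr => e _; rewrite big_bool /= !ffunE /= addrC.
by rewrite /dtail /dhead /= ![_ == (block_coord _).1]eq_sym.
Qed.

(** The [d] lifts of [e] and their signs assemble into one signed permutation: the sign of [(e, i)]
    is that of row [i], and the reversed lifts give the transpose. *)
Lemma signed_edge_blockE (f : {ffun edge G -> 'S_d})
    (s : {ffun edge G * 'I_d -> bool}) :
  \sum_(x : edge (covering_graph (labeling_of f)))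
    @signed_edge {poly C} (covering_graph (labeling_of f)) _ block_index x (s x) =
  \sum_e edge_block e (sperm_mx C (f e, [ffun i => s (e, i)]))
                      (sperm_mx C (f e, [ffun i => s (e, i)]))^T.
Proof.
transitivity (\sum_(e : edge G) \sum_(i : 'I_d) @signed_edge {poly C}
    (covering_graph (labeling_of f)) _ block_index (e, i) (s (e, i))).
  by rewrite pair_bigA; apply: eq_bigr => -[e i].
apply: eq_bigr => e _; apply/matrixP => a b; rewrite summxE edge_blockE.
under eq_bigr => i _.
  rewrite /signed_edge /edge_mx !mxE !eq_block_index /= ffunE /= mulrDr.
  rewrite [block_coord a]surjective_pairing [block_coord b]surjective_pairing.
  rewrite !xpair_eqE andbACA [in X in _ + X]andbACA [(_ == f e i) && _]andbC.
  over.
have sum_part (c : bool) (p : 'I_d) (q : pred 'I_d) :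
    \sum_i - (-1) ^+ s (e, i) * (c && ((p == i) && q i))%:R =
    - (if c then (-1) ^+ s (e, p) * (q p)%:R else 0)%:P :> {poly C}.
  case: c => /=; last by rewrite big1 ?oppr0 // => i _; rewrite mulr0.
  rewrite (bigD1 p) //= eqxx big1 => [|i nip]; last first.
    by rewrite eq_sym (negbTE nip) mulr0.
  by rewrite addr0 mulNr polyCM rmorphXn rmorphN1 polyC_natr.
rewrite big_split polyCD opprD; congr (_ + _).
  rewrite (sum_part (_ && _) _ (fun i => _ == f e i)) mxE ffunE.
  by rewrite [_ == f e _]eq_sym.
rewrite (sum_part (_ && _) _ (fun i => _ == f e i)) !mxE ffunE.
by rewrite [_ == f e _]eq_sym.
Qed.

(** A permutation for each edge and a sign for each of its lifts amount to one uniform signed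
    permutation for each edge. *)
Lemma expectation_coverings :
  uniform_expectation (coverings G d)
      (fun s => matching_poly (covering_graph s) C) =
  (#|{: 'S_d * {ffun 'I_d -> bool}}|%:R^-1)%:P ^+ #|edge G| *
  \sum_(k : {ffun edge G -> 'S_d * {ffun 'I_d -> bool}})
    \det ('X%:M + \sum_e edge_block e (sperm_mx C (k e)) (sperm_mx C (k e))^T).
Proof.
rewrite /coverings expectation_labelings.
transitivity ((#|'S_d|%:R^-1)%:P ^+ #|edge G| * \sum_(f : {ffun edge G -> 'S_d})
    (2^-1)%:P ^+ #|{: edge G * 'I_d}| *
    \sum_(s : {ffun edge G * 'I_d -> bool})
      \det ('X%:M + \sum_e edge_block e
        (sperm_mx C (f e, [ffun i => s (e, i)]))
        (sperm_mx C (f e, [ffun i => s (e, i)]))^T)).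
  congr (_ * _); apply: eq_bigr => f _.
  rewrite (matching_poly_avg C (H := covering_graph (labeling_of f))
    block_index_inj card_block).
  by congr (_ * _); apply: eq_bigr => s _; rewrite signed_edge_blockE.
rewrite -big_distrr /= pair_bigA mulrA /=; congr (_ * _).
  rewrite card_prod card_ord mulnC exprM -exprMn -rmorphXn -rmorphM /=.
  congr ((_ %:P) ^+ _).
  by rewrite card_prod card_ffun card_bool card_ord natrM natrX invfM exprVn.
pose h (p : {ffun edge G -> 'S_d} * {ffun edge G * 'I_d -> bool}) :
    {ffun edge G -> 'S_d * {ffun 'I_d -> bool}} :=
  [ffun e => (p.1 e, [ffun i => p.2 (e, i)])].
have h_bij : bijective h.
  exists (fun k : {ffun edge G -> 'S_d * {ffun 'I_d -> bool}} =>
     ([ffun e => (k e).1], [ffun x => (k x.1).2 x.2])).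
    case=> f s; congr (_, _); apply/ffunP => x; rewrite !ffunE //=.
    by case: x.
  move=> k; apply/ffunP => e; rewrite ffunE /= ffunE; case E: (k e) => [a b].
  by congr (_, _); apply/ffunP => i; rewrite !ffunE /= E.
rewrite [RHS](reindex h) /=; last exact: onW_bij.
apply: eq_bigr => p _; congr (\det (_ + _)); apply: eq_bigr => e _.
by rewrite ffunE.
Qed.

End BlockMatrices.

(** * Equality of the two expectations *)

Lemma expectation_eq (C : numClosedFieldType) (G : multigraph) (d : nat)
    (gT : finGroupType) (rG : mx_representation C [set: gT]%G d) :
  ext_powers_irr_distinct rG ->
  uniform_expectation (labelings G gT) (fun g => labeled_char_poly rG g) =
  uniform_expectation (coverings G d)
      (fun s => matching_poly (covering_graph s) C).
Proof.
move=> hrG; rewrite expectation_labelings expectation_coverings.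
under eq_bigr => f _ do rewrite labeled_char_polyE -[X in _ + X]sum_setT.
under [in RHS]eq_bigr => k _ do rewrite -[X in _ + X]sum_setT.
have cK (T : finType) (x : T) : (#|T|%:R^-1)%:P * #|T|%:R = 1 :> {poly C}.
  by rewrite -polyC_natr -polyCM mulVf // pnatr_eq0 -lt0n; apply/card_gt0P; exists x.
(* The labels are exchanged over the set of all edges, starting from the base point ['X%:M]. *)
apply: (avg_ffun_eq (F := fun X : 'M[{poly C}]_(\sum_(i < #|vertex G|) d) => \det X)
  (X1 := fun e g => edge_block e (rG g) (rG g^-1%g))
  (X2 := fun e k => edge_block e (sperm_mx C k) (sperm_mx C k)^T)).
- exact: (cK _ 1%g).
- exact: (cK _ (1%g, [ffun=> false])).
move=> e B; rewrite /edge_block.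
under eq_bigr => g _ do rewrite addrA.
under [in RHS]eq_bigr => g _ do rewrite addrA.
exact: avg_det_eq.
Qed.

Theorem theorem1p8 (R : realType) (G : multigraph) (hG : connected_graph G)
    (d : nat) (gT : finGroupType)
    (rG : mx_representation R[i] [set: gT]%G d)
    (hrG : ext_powers_irr_distinct rG) :
  uniform_expectation (labelings G gT) (fun g => labeled_char_poly rG g) =
    uniform_expectation (coverings G d)
      (fun s => matching_poly (covering_graph s) R[i]) /\
  (forall (gT' : finGroupType)
      (rG' : mx_representation R[i] [set: gT']%G d)
      (hrG' : ext_powers_irr_distinct rG'),
    uniform_expectation (labelings G gT) (fun g => labeled_char_poly rG g) =
    uniform_expectation (labelings G gT') (fun g => labeled_char_poly rG' g)).
Proof.
split; first exact: expectation_eq.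
by move=> gT' rG' hrG'; rewrite (expectation_eq G hrG) (expectation_eq G hrG').
Qed.
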